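(* Let $X$ be a Banach space. Then the following assertions are equivalent: (1) $X$ has the L-Dunford-Pettis property; (2) $W(X,\ell^{\infty})=DPcc(X,\ell^{\infty})$; (3) $W(X,\ell^{\infty})$ is complemented in $DPcc(X,\ell^{\infty})$.
   Context: $X'$ denotes the topological dual of the Banach space $X$; operators are bounded linear operators; $\ell^\infty$ is the Banach space of all bounded sequences. A norm bounded subset $A$ of $X$ is called Dunford-Pettis (DP) if every weakly null sequence $(f_n)$ in $X'$ satisfies $\lim_{n\to\infty}\sup_{x\in A}|f_n(x)|=0$. A sequence $(x_n)$ ''is a DP set'' if the set $\{x_n : n\in\mathbb{N}\}$ is a DP set. An operator $T:X\to Y$ between Banach spaces is Dunford-Pettis completely continuous (DPcc) if it maps every weakly null sequence in $X$ which is a DP set in $X$ to a norm null sequence in $Y$. $W(X,\ell^\infty)$ denotes the space of all weakly compact operators from $X$ into $\ell^\infty$ and $DPcc(X,\ell^\infty)$ the space of all Dunford-Pettis completely continuous operators from $X$ into $\ell^\infty$, both with the operator norm; every weakly compact operator is DPcc, so $W(X,\ell^\infty)\subseteq DPcc(X,\ell^\infty)$. A subspace $Z_1$ of a Banach space $Z$ is complemented in $Z$ if there exists a (bounded linear) projection from $Z$ onto $Z_1$. A norm bounded subset $A$ of $X'$ is called an L-Dunford-Pettis set if every weakly null sequence $(x_n)$ in $X$ which is a DP set in $X$ satisfies $\lim_{n\to\infty}\sup_{f\in A}|f(x_n)|=0$. A Banach space $X$ has the L-Dunford-Pettis property if every L-Dunford-Pettis set in $X'$ is relatively weakly compact. 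*)

(* Defs.v *)
From HB Require Import structures.
From mathcomp Require Import all_boot all_order all_algebra.
From mathcomp Require Import all_classical all_reals all_analysis.

Set Implicit Arguments.
Unset Strict Implicit.
Unset Printing Implicit Defensive.

Import Order.TTheory GRing.Theory Num.Theory.
Import numFieldNormedType.Exports.

Local Open Scope classical_set_scope.
Local Open Scope ring_scope.

Section bounded_operators.
Context {R : realType} (X Y : normedModType R).

Definition is_bounded_op : {pred X -> Y} :=
  [pred f : X -> Y | `[< linear f /\ continuous f >]].

Record boundedOp := BoundedOp {
  bop_fun :> X -> Y;
  bop_funP : bop_fun \in is_bounded_op }.

HB.instance Definition _ := [isSub for bop_fun].
HB.instance Definition _ := [Choice of boundedOp by <:].

Lemma is_bounded_opP (f : X -> Y) :
  reflect (linear f /\ continuous f) (f \in is_bounded_op).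
Proof. by rewrite inE; exact: asboolP. Qed.

Fact is_bounded_op_submod : submod_closed is_bounded_op.
Proof.
split.
  apply/is_bounded_opP; split; last by move=> x; exact: cvg_cst.
  by move=> a u v /=; rewrite [RHS]addr0 [RHS]scaler0.
move=> a f g /is_bounded_opP[lf cf] /is_bounded_opP[lg cg].
apply/is_bounded_opP; split.
  move=> b u v; rewrite [LHS]/(a *: f _ + g _) [RHS]/(b *: (a *: f _ + g _) + _).
  rewrite lf lg !scalerDr !scalerA (mulrC a b); exact: addrACA.
by move=> x; apply: cvgD; [apply: cvgZr; exact: cf|exact: cg].
Qed.

HB.instance Definition _ :=
  GRing.isSubmodClosed.Build R (X -> Y) is_bounded_op is_bounded_op_submod.
HB.instance Definition _ := [SubChoice_isSubLmodule of boundedOp by <:].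

Lemma bop_linear (f : boundedOp) : linear f.
Proof. by have /is_bounded_opP[] := bop_funP f. Qed.

Lemma bop_continuous (f : boundedOp) : continuous f.
Proof. by have /is_bounded_opP[] := bop_funP f. Qed.

HB.instance Definition _ (f : boundedOp) :=
  GRing.isLinear.Build R X Y *:%R (bop_fun f) (bop_linear f).

Definition op_norm (f : boundedOp) : R :=
  sup [set `|f x| | x in [set x | `|x| <= 1]].

Fact op_norm_has_sup (f : boundedOp) :
  has_sup [set `|f x| | x in [set x | `|x| <= 1]].
Proof.
split; first by exists `|f 0|, 0 => //=; rewrite normr0.
have /linear_bounded_continuous/bounded_funP/(_ 1)[M fM] := @bop_continuous f.
by exists M => _ [x x1 <-]; exact: fM.
Qed.

Lemma op_norm_ge (f : boundedOp) (x : X) : `|x| <= 1 -> `|f x| <= op_norm f.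
Proof. by move=> x1; apply: (sup_upper_bound (op_norm_has_sup f)); exists x. Qed.

Lemma op_norm_le (f : boundedOp) (M : R) :
  (forall x, `|x| <= 1 -> `|f x| <= M) -> op_norm f <= M.
Proof.
move=> fM; apply: ge_sup; first by case: (op_norm_has_sup f).
by move=> _ [x x1 <-]; exact: fM.
Qed.

Lemma le_op_norm (f : boundedOp) (x : X) : `|f x| <= op_norm f * `|x|.
Proof.
have [->|x0] := eqVneq x 0; first by rewrite linear0 !normr0 mulr0.
have nx0 : 0 < `|x| by rewrite normr_gt0.
rewrite -ler_pdivrMr// mulrC -[X in X * _]ger0_norm ?invr_ge0//.
rewrite -normrZ -linearZ; apply: op_norm_ge.
by rewrite normrZ ger0_norm ?invr_ge0// mulVf ?gt_eqF.
Qed.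

Fact op_normD (f g : boundedOp) : op_norm (f + g) <= op_norm f + op_norm g.
Proof.
apply: op_norm_le => x x1; apply: (le_trans (ler_normD _ _)).
by apply: lerD; exact: op_norm_ge.
Qed.

Fact op_normZ (a : R) (f : boundedOp) : op_norm (a *: f) = `|a| * op_norm f.
Proof.
apply/eqP; rewrite eq_le; apply/andP; split.
  apply: op_norm_le => x x1.
  by rewrite [_ x]/(a *: f x) normrZ ler_wpM2l// op_norm_ge.
have [->|a0] := eqVneq a 0.
  rewrite normr0 mul0r; apply: le_trans (@op_norm_ge _ 0 _) => //.
  by rewrite normr0.
rewrite -ler_pdivlMl ?normr_gt0//; apply: op_norm_le => x x1.
by rewrite ler_pdivlMl ?normr_gt0// -normrZ; exact: (@op_norm_ge (a *: f)).
Qed.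

Fact op_norm_eq0 (f : boundedOp) : op_norm f = 0 -> f = 0.
Proof.
move=> f0; apply/val_inj/funext => x; apply/eqP; rewrite -normr_le0.
by apply: le_trans (le_op_norm f x) _; rewrite f0 mul0r.
Qed.

HB.instance Definition _ :=
  Lmodule_isNormed.Build R boundedOp op_normD op_normZ op_norm_eq0.

Lemma bop_normE (f : boundedOp) : `|f| = op_norm f. Proof. by []. Qed.

End bounded_operators.

Notation dual X := (boundedOp X (_ ^o)).

Section linfty.
Context {R : realType}.

Definition is_bounded_seq : {pred nat -> R} :=
  [pred u : nat -> R | `[< bounded_fun u >]].

Record linfty := Linfty {
  linfty_fun :> nat -> R;
  linfty_funP : linfty_fun \in is_bounded_seq }.

HB.instance Definition _ := [isSub for linfty_fun].
HB.instance Definition _ := [Choice of linfty by <:].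

Lemma is_bounded_seqP (u : nat -> R) :
  reflect (exists M, forall n, `|u n| <= M) (u \in is_bounded_seq).
Proof.
rewrite inE; apply: (iffP (asboolP _)) => /=.
  by move=> [M [_ uM]]; exists (M + 1) => n; apply: uM => //; rewrite ltrDl.
move=> [M uM]; exists M; split; first exact: num_real.
by move=> N MN n _; apply: le_trans (uM n) (ltW MN).
Qed.

Fact is_bounded_seq_submod : submod_closed is_bounded_seq.
Proof.
split; first by apply/is_bounded_seqP; exists 0 => n; rewrite normr0.
move=> a u v /is_bounded_seqP[M uM] /is_bounded_seqP[N vN].
apply/is_bounded_seqP; exists (`|a| * M + N) => n.
apply: (le_trans (ler_normD _ _)); apply: lerD; last exact: vN.
by rewrite normrM ler_wpM2l.
Qed.

HB.instance Definition _ :=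
  GRing.isSubmodClosed.Build R (nat -> R) is_bounded_seq is_bounded_seq_submod.
HB.instance Definition _ := [SubChoice_isSubLmodule of linfty by <:].

Definition linfty_norm (u : linfty) : R := sup (range (fun n => `|u n|)).

Fact linfty_norm_has_sup (u : linfty) : has_sup (range (fun n => `|u n|)).
Proof.
split; first by exists `|u 0|, 0%N.
have /is_bounded_seqP[M uM] := linfty_funP u.
by exists M => _ [n _ <-].
Qed.

Lemma linfty_norm_ge (u : linfty) (n : nat) : `|u n| <= linfty_norm u.
Proof. by apply: (sup_upper_bound (linfty_norm_has_sup u)); exists n. Qed.

Lemma linfty_norm_le (u : linfty) (M : R) :
  (forall n, `|u n| <= M) -> linfty_norm u <= M.
Proof.
move=> uM; apply: ge_sup; first by case: (linfty_norm_has_sup u).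
by move=> _ [n _ <-].
Qed.

Fact linfty_normD (u v : linfty) :
  linfty_norm (u + v) <= linfty_norm u + linfty_norm v.
Proof.
apply: linfty_norm_le => n; apply: (le_trans (ler_normD _ _)).
by apply: lerD; exact: linfty_norm_ge.
Qed.

Fact linfty_normZ (a : R) (u : linfty) :
  linfty_norm (a *: u) = `|a| * linfty_norm u.
Proof.
apply/eqP; rewrite eq_le; apply/andP; split.
  apply: linfty_norm_le => n.
  by rewrite [_ n]/(a * u n) normrM ler_wpM2l// linfty_norm_ge.
have [->|a0] := eqVneq a 0.
  by rewrite normr0 mul0r; apply: le_trans (@linfty_norm_ge _ 0).
rewrite -ler_pdivlMl ?normr_gt0//; apply: linfty_norm_le => n.
by rewrite ler_pdivlMl ?normr_gt0// -normrM; exact: (@linfty_norm_ge (a *: u)).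
Qed.

Fact linfty_norm_eq0 (u : linfty) : linfty_norm u = 0 -> u = 0.
Proof.
move=> u0; apply/val_inj/funext => n; apply/eqP; rewrite -normr_le0.
by apply: le_trans (linfty_norm_ge u n) _; rewrite u0.
Qed.

HB.instance Definition _ :=
  Lmodule_isNormed.Build R linfty linfty_normD linfty_normZ linfty_norm_eq0.

Lemma linfty_normE (u : linfty) : `|u| = linfty_norm u. Proof. by []. Qed.

End linfty.
Arguments linfty R : clear implicits.

Section weak_topology.
Context {R : realType} (X : normedModType R).

(** [X] with the coarsest topology making every element of [dual X]
    continuous *)
Definition weak : topologicalType :=
  initial_topology (fun x : X => (fun f => f x) : {ptws dual X -> R}).

Definition weakly_null (x : nat -> X) : Prop :=
  (x : nat -> weak) @ \oo --> (0 : weak).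

Definition relatively_weakly_compact (A : set X) : Prop :=
  precompact (A : set weak).

Lemma weakly_nullP (x : nat -> X) :
  weakly_null x <-> forall f : dual X, f (x n) @[n --> \oo] --> (0 : R).
Proof.
split=> [x0 f|x0].
  rewrite -(linear0 f).
  pose w (y : weak) : {ptws dual X -> R} := fun g => g y.
  have wc : w @ (0 : weak) --> w 0 by exact: initial_continuous.
  have fc : h f @[h --> w 0] --> w 0 f.
    exact: (@proj_continuous _ (fun=> R : topologicalType) f).
  exact: cvg_comp (cvg_comp _ _ x0 wc) fc.
move=> A [_ [[W oW <-] /= W0 WA]].
suff : (fun n => (fun f => f (x n)) : {ptws dual X -> R}) @ \oo -->
    ((fun f => f 0) : {ptws dual X -> R}).
  move=> /(_ W (open_nbhs_nbhs (conj oW W0))).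
  exact: (@filterS _ \oo _ _ _ (fun n => WA (x n))).
apply/cvg_sup => f B [_ [[U oU <-] /= U0 UB]].
have := x0 f; rewrite -(linear0 f) => /(_ U (open_nbhs_nbhs (conj oU U0))).
exact: (@filterS _ \oo _ _ _ (fun n => UB (fun g : dual X => g (x n)))).
Qed.

End weak_topology.

Section dunford_pettis.
Context {R : realType}.
Implicit Types X Y : normedModType R.

(** [sup] is [0] on sets that are empty or unbounded above; the boundedness of
    [A] makes it the actual supremum below, up to the case [A = set0]. *)
Definition DP_set X (A : set X) : Prop :=
  bounded_set A /\
  forall f : nat -> dual X, weakly_null f ->
    sup [set `|f n x| | x in A] @[n --> \oo] --> (0 : R).

Definition L_DP_set X (A : set (dual X)) : Prop :=
  bounded_set A /\
  forall x : nat -> X, weakly_null x -> DP_set (range x) ->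
    sup [set `|f (x n)| | f in A] @[n --> \oo] --> (0 : R).

Definition L_DP_property X : Prop :=
  forall A : set (dual X), L_DP_set A -> relatively_weakly_compact A.

Definition weakly_compact_ops X Y : set (boundedOp X Y) :=
  [set T | forall A : set X,
     bounded_set A -> relatively_weakly_compact (T @` A)].

Definition DPcc_ops X Y : set (boundedOp X Y) :=
  [set T | forall x : nat -> X, weakly_null x -> DP_set (range x) ->
     T (x n) @[n --> \oo] --> (0 : Y)].

End dunford_pettis.
Arguments weakly_compact_ops {R} X Y.
Arguments DPcc_ops {R} X Y.

Section complemented.
Context {R : realType} (V : normedModType R).

(** [P] is a bounded linear projection from the subspace [Z] of [V] onto [Z1];
    its values outside [Z] are irrelevant. *)
Definition projection_onto (Z Z1 : set V) (P : V -> V) : Prop :=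
  [/\ forall (a : R) (u v : V), Z u -> Z v -> P (a *: u + v) = a *: P u + P v,
      exists M : R, forall u, Z u -> `|P u| <= M * `|u|,
      P @` Z = Z1 &
      forall u, Z u -> P (P u) = P u].

Definition complemented_in (Z1 Z : set V) : Prop :=
  Z1 `<=` Z /\ exists P : V -> V, projection_onto Z Z1 P.

End complemented.

(* Main.v *)
From HB Require Import structures.
Require Import Defs.
From mathcomp Require Import all_boot all_order all_algebra.
From mathcomp Require Import all_classical all_reals all_analysis.
From mathcomp Require Import ring lra.
Import Order.TTheory GRing.Theory Num.Theory.
Import numFieldNormedType.Exports.
Set Implicit Arguments.
Unset Strict Implicit.
Unset Printing Implicit Defensive.

Local Open Scope classical_set_scope.
Local Open Scope ring_scope.

(** Write [W] and [D] for the weakly compact and the Dunford-Pettis completely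
    continuous operators from [X] to l^infty, [T''] for the second adjoint of
    an operator [T], and identify a Banach space with its image in its bidual.
    With (1) the L-Dunford-Pettis property, (2) the equality [W = D] and (3)
    the complementation of [W] in [D], the proof is the cycle (1), (2), (3),
    (1).

    The common tool is Gantmacher's criterion: [T] is weakly compact if and
    only if [T''] takes its values in l^infty ([weakly_compact_bitranspose] and
    [bitranspose_weakly_compact]). One direction is Goldstine's theorem,
    derived here from a least-squares argument ([helly_approx]); the other one
    and most compactness arguments below are limits of functionals along
    ultrafilters ([ultralimit_functional]).

    (1) implies (2). The inclusion of [W] in [D] ([weakly_compact_DPcc]) holds
    for every [X]. If [T] is weakly compact, every sequence of coordinates of
    [T] has a subsequence [h] that converges weakly to some [f] in [X']
    ([weakly_compact_coord_subseq]): countably many vectors decide when two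
    functionals of l^infty agree on the range of [T], so that a diagonal
    extraction suffices. If [x] is weakly null and a DP set, then [h m - f]
    tends to 0 uniformly on [x] and [f (x n)] tends to 0, hence the coordinates
    of [T (x n)] cannot stay away from 0. Conversely, if [T] is in [D], then
    the image of the dual unit ball under the adjoint of [T] is an
    L-Dunford-Pettis set, hence relatively weakly compact, and Gantmacher's
    criterion follows ([adjoint_rwc_bitranspose]).

    (2) implies (3): the identity is a projection.

    (3) implies (1) ([complemented_L_DP_property]). An L-Dunford-Pettis set
    that is not relatively weakly compact contains functionals [f n] such that,
    for suitable bounded [x m], the numbers [f n (x m)] are less than [a] for
    [m < n] and more than [b] for [n <= m], where [a < b]
    ([not_rwc_separation]). For [u] in l^infty the operator [T u : x |-> (u n *
    f n x)_n] belongs to [D], and to [W] when [u] is one of the coordinate unit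
    vectors. If [P] is a bounded projection of [D] onto [W], the countably many
    functionals [u |-> ((P (T u) - T u) (x m))_n] vanish on the coordinate unit
    vectors, hence on the indicator function of some infinite set [I] of
    indices, which is found in an uncountable almost disjoint family
    ([vanishing_on_infinite_set]). Then [P (T 1_I)] is weakly compact and
    coincides with [T 1_I] on the vectors [x m], although weak compactness
    forbids the separation by [a] and [b] along [I]
    ([weakly_compact_interchange]). *)

(** * Limits along ultrafilters *)

Lemma ultra_fmap (T S : Type) (f : T -> S) (U : set_system T) :
  UltraFilter U -> UltraFilter (f @ U).
Proof.
move=> UU; split; first exact: fmap_proper_filter.
move=> G GF sG; rewrite eqEsubset; split=> // A GA.
have [//|UA] := in_ultra_setVsetC (f @^-1` A) UU.
have GcA : G (~` A) by exact: sG.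
by have /filter_ex[x []] : G (A `&` ~` A) by exact: filterI.
Qed.

Lemma ultra_bounded_cvg (R : realType) (T : Type) (U : set_system T)
    (u : T -> R) (M : R) :
  UltraFilter U -> U [set t | `|u t| <= M] -> exists l : R, u @ U --> l.
Proof.
move=> UU uM; have /= := @segment_compact R (- M) M; rewrite compact_ultra.
move=> /(_ _ (ultra_fmap u UU)) [|l [_ ul]]; last by exists l.
by rewrite /= /fmap /=; apply: filterS uM => t /=; rewrite in_itv/= -ler_norml.
Qed.

Lemma infinite_ultra (A : set nat) : (forall n, exists2 m, (n <= m)%N & A m) ->
  exists U : set_system nat, [/\ UltraFilter U, \oo `<=` U & U A].
Proof.
move=> Ainf; have PF : ProperFilter (within A \oo).
  apply: Build_ProperFilter_ex => P [N _ NP].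
  by have [m Nm Am] := Ainf N; exists m; exact: NP.
have [U [UU sU]] := ultraFilterLemma PF; exists U; split=> //.
  by move=> P oP; apply: sU; apply: filterS oP => n Pn _.
by apply: sU; exists 0%N.
Qed.

(** Convergence of a sequence can be tested along the ultrafilters finer than
    the filter of neighbourhoods of infinity. *)
Lemma cvg_ultraP (R : realType) (u : nat -> R) (l : R) :
  (forall U : set_system nat, UltraFilter U -> \oo `<=` U -> u @ U --> l) ->
  u @ \oo --> l.
Proof.
move=> uU A lA; apply: contrapT => NA.
have [n|U [UU sU UA]] := @infinite_ultra (~` (u @^-1` A)).
  apply: contrapT => nA; apply: NA; exists n => // m /= nm.
  by apply: contrapT => Am; apply: nA; exists m.
have UuA : U (u @^-1` A) by exact: uU.
by have /filter_ex[x []] : U (~` (u @^-1` A) `&` (u @^-1` A)) by exact: filterI.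
Qed.

(** * Bounded operators, functionals and their ultralimits *)

Section operators.
Context {R : realType}.
Implicit Types X Y Z : normedModType R.

Lemma bounded_linear_is_op X Y (f : X -> Y) : linear f ->
  (exists M, forall x, `|f x| <= M * `|x|) -> f \in @is_bounded_op R X Y.
Proof.
move=> lf [M fM]; apply/is_bounded_opP; split=> //.
pose F : {linear X -> Y} := HB.pack f (GRing.isLinear.Build _ _ _ _ f lf).
apply/(linear_bounded_continuous F)/bounded_funP => r.
exists (`|M| * r) => x xr.
apply: le_trans (fM x) _.
apply: le_trans (ler_wpM2r (normr_ge0 _) (ler_norm M)) _.
exact: ler_wpM2l.
Qed.

(** the bounded operator with underlying function [f] *)
Definition mkop X Y (f : X -> Y) (lf : linear f)
    (bf : exists M, forall x, `|f x| <= M * `|x|) : boundedOp X Y :=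
  BoundedOp (bounded_linear_is_op lf bf).

Lemma mkopE X Y (f : X -> Y) lf bf x : @mkop X Y f lf bf x = f x.
Proof. by []. Qed.

Lemma le_opnorm X Y (f : boundedOp X Y) x : `|f x| <= `|f| * `|x|.
Proof. exact: le_op_norm. Qed.

Lemma opnorm_le X Y (f : boundedOp X Y) M :
  (forall x, `|x| <= 1 -> `|f x| <= M) -> `|f| <= M.
Proof. exact: op_norm_le. Qed.

Lemma opP X Y (f g : boundedOp X Y) : (forall x, f x = g x) -> f = g.
Proof. by move=> fg; apply/val_inj/funext. Qed.

Lemma opD X Y (f : boundedOp X Y) x y : f (x + y) = f x + f y.
Proof. exact: linearD. Qed.

Lemma opN X Y (f : boundedOp X Y) x : f (- x) = - f x.
Proof. exact: linearN. Qed.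

Lemma opZ X Y (f : boundedOp X Y) a x : f (a *: x) = a *: f x.
Proof. exact: linearZ. Qed.

Lemma addopE X Y (f g : boundedOp X Y) x : (f + g) x = f x + g x.
Proof. by []. Qed.

Lemma oppopE X Y (f : boundedOp X Y) x : (- f) x = - f x.
Proof. by []. Qed.

Lemma scaleopE X Y (f : boundedOp X Y) a x : (a *: f) x = a *: f x.
Proof. by []. Qed.

Lemma bounded_setP X (A : set X) :
  bounded_set A <-> exists M, forall x, A x -> `|x| <= M.
Proof.
split=> [[M [_ AM]]|[M AM]].
  by exists (M + 1) => x Ax; apply: AM => //; rewrite ltrDl.
exists M; split; first exact: num_real.
by move=> N MN x Ax; apply: le_trans (AM x Ax) (ltW MN).
Qed.

Lemma linftyP (u v : linfty R) : (forall n, u n = v n) -> u = v.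
Proof. by move=> uv; apply/val_inj/funext. Qed.

Lemma add_linftyE (u v : linfty R) n : (u + v) n = u n + v n.
Proof. by []. Qed.

Lemma opp_linftyE (u : linfty R) n : (- u) n = - u n.
Proof. by []. Qed.

Lemma scale_linftyE (a : R) (u : linfty R) n : (a *: u) n = a * u n.
Proof. by []. Qed.

Section comp.
Context {X Y Z : normedModType R} (g : boundedOp Y Z) (f : boundedOp X Y).

Fact opcomp_linear : linear (fun x => g (f x)).
Proof. by move=> a u v; rewrite !linearP. Qed.

Fact opcomp_bounded : exists M, forall x, `|g (f x)| <= M * `|x|.
Proof.
exists (`|g| * `|f|) => x; apply: le_trans (le_opnorm _ _) _.
by rewrite -mulrA ler_wpM2l// le_opnorm.
Qed.

(** the composite of two bounded operators; for a functional [g], the image of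
    [g] under the adjoint of [f] *)
Definition opcomp : boundedOp X Z := mkop opcomp_linear opcomp_bounded.

Lemma opcompE x : opcomp x = g (f x). Proof. by []. Qed.

Lemma opcomp_norm : `|opcomp| <= `|g| * `|f|.
Proof.
apply: opnorm_le => x x1; rewrite opcompE; apply: le_trans (le_opnorm _ _) _.
rewrite ler_wpM2l//; apply: le_trans (le_opnorm _ _) _.
by rewrite ler_piMr.
Qed.

End comp.

Section evaluation.
Context {X : normedModType R} (x : X).

Fact evalop_linear : linear (fun f : dual X => f x : R^o).
Proof. by []. Qed.

Fact evalop_bounded : exists M, forall f : dual X, `|f x| <= M * `|f|.
Proof. by exists `|x| => f; rewrite mulrC; exact: le_opnorm. Qed.

(** the canonical image of [x] in the bidual *)
Definition evalop : dual (dual X) := mkop evalop_linear evalop_bounded.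

Lemma evalopE f : evalop f = f x. Proof. by []. Qed.

Lemma evalop_norm : `|evalop| <= `|x|.
Proof.
apply: opnorm_le => f f1; apply: le_trans (le_opnorm f x) _.
by rewrite ler_piMl.
Qed.

End evaluation.

Section coordinate.
Variable n : nat.

Fact coord_linear : linear (fun u : linfty R => u n : R^o).
Proof. by []. Qed.

Fact coord_bounded : exists M, forall u : linfty R, `|u n| <= M * `|u|.
Proof. by exists 1 => u; rewrite mul1r; exact: linfty_norm_ge. Qed.

(** the [n]-th coordinate, as a functional *)
Definition coord : dual (linfty R) := mkop coord_linear coord_bounded.

Lemma coordE u : coord u = u n. Proof. by []. Qed.

Lemma coord_norm : `|coord| <= 1.
Proof.
by apply: opnorm_le => u; apply: le_trans; exact: linfty_norm_ge.
Qed.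

End coordinate.

(** A bounded family of functionals converges pointwise along any ultrafilter
    to a functional. *)
Lemma ultralimit_functional X (T : Type) (U : set_system T) (F : T -> dual X)
    (M : R) : UltraFilter U -> U [set t | `|F t| <= M] ->
  exists2 g : dual X, `|g| <= M &
    forall x, (F t x : R) @[t --> U] --> (g x : R).
Proof.
move=> UU FM.
have FMx x : U [set t | `|F t x : R| <= M * `|x|].
  apply: filterS FM => t /= tM; apply: le_trans (le_opnorm _ _) _.
  exact: ler_wpM2r.
have [g gl] := choice (fun x => ultra_bounded_cvg UU (FMx x)).
have lg : linear (g : X -> R^o).
  move=> a u v; apply: (cvg_unique _ (gl (a *: u + v))) => //=.
  have -> : (fun t => F t (a *: u + v) : R) =
      (fun t => a * (F t u : R) + (F t v : R)).
    by apply/funext => t; rewrite linearP.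
  by apply: cvgD => //; apply: cvgM => //; exact: cvg_cst.
have bg x : `|g x : R^o| <= M * `|x|.
  exact: (cvgr_to_le (cvg_norm (gl x)) (FMx x)).
exists (mkop lg (ex_intro _ M bg)) => //.
have [t tM] := filter_ex FM; have M0 : 0 <= M := le_trans (normr_ge0 _) tM.
by apply: opnorm_le => x x1; apply: le_trans (bg x) _; rewrite ler_piMr.
Qed.

(** * The weak topology *)

Lemma weak_continuous X (f : dual X) (x : X) (F : set_system X) :
  Filter F -> (F : set_system (weak X)) --> (x : weak X) ->
  (f y : R) @[y --> F] --> (f x : R).
Proof.
move=> FF Fx; pose w (y : weak X) : {ptws dual X -> R} := fun g => g y.
have wc : w @ (x : weak X) --> w x by exact: initial_continuous.
have fc : h f @[h --> w x] --> w x f.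
  exact: (@proj_continuous _ (fun=> R : topologicalType) f).
exact: cvg_comp (cvg_comp _ _ Fx wc) fc.
Qed.

Lemma weak_cvg X (x : X) (F : set_system X) : Filter F ->
  (forall f : dual X, (f y : R) @[y --> F] --> (f x : R)) ->
  (F : set_system (weak X)) --> (x : weak X).
Proof.
move=> FF Fx A [_ [[W oW <-] /= W0 WA]].
suff : ((fun y => (fun f => f y) : {ptws dual X -> R}) @ F) -->
    ((fun f => f x) : {ptws dual X -> R}).
  move=> /(_ W (open_nbhs_nbhs (conj oW W0))).
  exact: (@filterS _ F _ _ _ WA).
apply/cvg_sup => f B [_ [[V oV <-] /= V0 VB]].
have := Fx f => /(_ V (open_nbhs_nbhs (conj oV V0))).
exact: (@filterS _ F _ _ _ (fun y => VB (fun g : dual X => g y))).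
Qed.

Lemma weak_open_lt X (f : dual X) (a : R) :
  open [set x : weak X | (f x : R) < a].
Proof.
rewrite openE => x /= fxa.
have FF : Filter (nbhs (x : weak X)) by exact: nbhs_filter.
have := @weak_continuous X f x _ FF cvg_id.
by move=> /(_ [set y | y < a]); apply; exact: lt_nbhsl.
Qed.

Lemma weak_open_gt X (f : dual X) (a : R) :
  open [set x : weak X | a < (f x : R)].
Proof.
rewrite openE => x /= fxa.
have FF : Filter (nbhs (x : weak X)) by exact: nbhs_filter.
have := @weak_continuous X f x _ FF cvg_id.
by move=> /(_ [set y | a < y]); apply; exact: lt_nbhsr.
Qed.

Lemma weak_hausdorff X :
  (forall x y : X, (forall f : dual X, f x = f y) -> x = y) ->
  hausdorff_space (weak X).
Proof.
move=> sepX x y xy; apply: sepX => f.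
have key (g : dual X) : ~~ ((g x : R) < g y).
  apply/negP => gxy; have [/midf_lt [h1 h2]] := (gxy, tt).
  have [z [/= ]] := xy _ _ (open_nbhs_nbhs (conj (@weak_open_lt X g _) h1))
    (open_nbhs_nbhs (conj (@weak_open_gt X g _) h2)).
  by move=> /lt_trans/[apply]; rewrite ltxx.
have := key f; have := key (- f).
rewrite !oppopE ltrN2 -!leNgt => h1 h2.
by apply/eqP; rewrite eq_le; apply/andP.
Qed.

(** An ultrafilter on a relatively weakly compact set converges weakly. *)
Lemma rwc_ultra_cvg X (A : set X) (U : set_system X) :
  relatively_weakly_compact A -> UltraFilter U -> U A ->
  exists y : X, forall f : dual X, (f x : R) @[x --> U] --> (f y : R).
Proof.
rewrite /relatively_weakly_compact precompactE compact_ultra => cA UU UA.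
have [|y [_ /= Uy]] := cA U UU.
  by apply: filterS UA; exact: (@subset_closure (weak X)).
by exists y => f; apply: weak_continuous.
Qed.

End operators.
(** * Approximation in convex sets *)

Section helly.
Context {R : realType} {V : lmodType R} {I : Type} (B : set V)
  (f : I -> V -> R) (v : I -> R).
Hypothesis B0 : B !=set0.
Hypothesis convB : forall x y t, B x -> B y -> 0 <= t <= 1 ->
  B (x + t *: (y - x)).
Hypothesis linf : forall i a x y, f i (a *: x + y) = a * f i x + f i y.
Hypothesis bndf : forall i, exists K, forall x, B x -> `|f i x| <= K.
Hypothesis sepv : forall (s : seq I) (c : I -> R) (M : R),
  (forall x, B x -> \sum_(i <- s) c i * f i x <= M) ->
  \sum_(i <- s) c i * v i <= M.

(** If no half-space separates [v] from the image of [B], then the image comes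
    arbitrarily close to [v] on finitely many coordinates.  Otherwise let [d]
    be the infimum of the squared distances: the normal direction at a
    near-minimiser gives a separating half-space. *)
Lemma helly_approx (s : seq I) (e : R) : 0 < e ->
  exists2 x, B x & \sum_(i <- s) (f i x - v i) ^+ 2 < e.
Proof.
move=> e0; apply: contrapT => nB.
pose G x := \sum_(i <- s) (f i x - v i) ^+ 2.
have Ge x : B x -> e <= G x.
  by move=> Bx; rewrite leNgt; apply/negP => Gx; apply: nB; exists x.
have [K fK] := choice bndf.
have infG : has_inf (G @` B).
  split; first by case: B0 => x Bx; exists (G x), x.
  by exists e => _ [x Bx <-]; exact: Ge.
pose d := inf (G @` B).
have de : e <= d.
  by apply: lb_le_inf; [exact: infG.1|move=> _ [x Bx <-]; exact: Ge].
have d0 : 0 < d by exact: lt_le_trans de.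
have dG x : B x -> d <= G x.
  by move=> Bx; apply: (ge_inf infG.2); exists x.
pose L := d + \sum_(i <- s) (K i + K i) ^+ 2.
have sL : 0 <= \sum_(i <- s) (K i + K i) ^+ 2.
  by apply: sumr_ge0 => i _; exact: sqr_ge0.
have dL : d <= L by rewrite lerDl.
have L0 : 0 < L by exact: lt_le_trans dL.
have NL x y : B x -> B y -> \sum_(i <- s) (f i y - f i x) ^+ 2 <= L.
  move=> Bx By; apply: (@le_trans _ _ (\sum_(i <- s) (K i + K i) ^+ 2)).
    apply: ler_sum => i _; rewrite -[leLHS]real_normK ?num_real//.
    rewrite lerXn2r ?nnegrE//.
      apply: addr_ge0; exact: le_trans (normr_ge0 _) (fK i x Bx).
    by apply: (le_trans (ler_normB _ _)); apply: lerD; exact: fK.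
  by rewrite lerDr ltW.
(* along the segment from [x0] to [x], the second-order term of the squared
   distance to [v] at [t] is at most [t ^+ 2 * L = t * (d / 2)] *)
pose t := d / (2 * L).
have t0 : 0 < t by rewrite divr_gt0// mulr_gt0.
have tL : t * L = d / 2 by rewrite /t; field; rewrite gt_eqF.
have t1 : t <= 1 by rewrite ler_pdivrMr ?mulr_gt0// mul1r; lra.
have td0 : 0 < t * d / 2 by rewrite divr_gt0// mulr_gt0.
have [_ [x0 Bx0 <-] Gx0] := inf_adherent td0 infG.
have half x : B x -> \sum_(i <- s) (v i - f i x0) * (f i x - f i x0) <= d / 2.
  move=> Bx; set S := \sum_(i <- s) _.
  have Gt : G (x0 + t *: (x - x0)) = G x0 - 2 * t * S +
      t ^+ 2 * \sum_(i <- s) (f i x - f i x0) ^+ 2.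
    rewrite /G /S !mulr_sumr -sumrB -big_split/=; apply: eq_bigr => i _.
    have -> : f i (x0 + t *: (x - x0)) = f i x0 + t * (f i x - f i x0).
      by rewrite addrC linf -[x - x0]addrC -scaleN1r linf; ring.
    by ring.
  have tt : 0 <= t <= 1 by rewrite ltW.
  have := dG _ (convB Bx0 Bx tt); rewrite Gt.
  have := ler_wpM2l (sqr_ge0 t) (NL _ _ Bx0 Bx).
  have -> : t ^+ 2 * L = t * (d / 2) by rewrite expr2 -mulrA tL.
  move: Gx0; rewrite -/d => h1 h2 h3.
  suff : t * S <= t * (d / 2) by rewrite ler_pM2l.
  lra.
have := sepv (s := s) (c := fun i => v i - f i x0)
  (M := \sum_(i <- s) (v i - f i x0) * f i x0 + d / 2).
have -> : \sum_(i <- s) (v i - f i x0) * v i =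
    \sum_(i <- s) (v i - f i x0) * f i x0 + G x0.
  by rewrite /G -big_split/=; apply: eq_bigr => i _; ring.
have h := dG _ Bx0.
suff H x : B x -> \sum_(i <- s) (v i - f i x0) * f i x <=
    \sum_(i <- s) (v i - f i x0) * f i x0 + d / 2 by move=> /(_ H); lra.
move=> Bx; rewrite -lerBlDl -sumrB; apply: le_trans (half x Bx).
by apply: ler_sum => i _; rewrite mulrBr.
Qed.

(** The approximations of [helly_approx] form a filter base. *)
Lemma helly_ultra : exists U : set_system V,
  [/\ UltraFilter U, U B & forall i, f i x @[x --> U] --> v i].
Proof.
pose F : set_system V := [set A | exists s e, 0 < e /\
  forall x, B x -> \sum_(i <- s) (f i x - v i) ^+ 2 < e -> A x].
have sq s x : 0 <= \sum_(i <- s) (f i x - v i) ^+ 2.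
  by apply: sumr_ge0 => i _; exact: sqr_ge0.
have PF : ProperFilter F.
  apply: Build_ProperFilter_ex.
    move=> A [s [e [e0 sA]]]; have [x Bx xe] := helly_approx s e0.
    by exists x; exact: sA.
  split=> [|A C [s [e [e0 sA]]] [r [d [d0 rC]]]|A C AC [s [e [e0 sA]]]].
  - by exists [::], 1.
  - exists (s ++ r), (Num.min e d); split; first by rewrite lt_min e0.
    move=> x Bx; rewrite big_cat/= lt_min => /andP[xe xd]; split.
    + by apply: sA => //; apply: le_lt_trans xe; rewrite lerDl.
    + by apply: rC => //; apply: le_lt_trans xd; rewrite lerDr.
  - by exists s, e; split=> // x Bx xs; apply: AC; exact: sA.
have [U [UU sU]] := ultraFilterLemma PF; exists U; split=> //.
  by apply: sU; exists [::], 1.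
move=> i; apply/cvgrPdist_lt => e e0; apply: sU.
exists [:: i], (e ^+ 2); split; first exact: exprn_gt0.
move=> x _; rewrite big_seq1 -[ltLHS]real_normK ?num_real// distrC.
by rewrite ltr_pXn2r// nnegrE// ltW.
Qed.

End helly.

Section goldstine.
Context {R : realType}.
Implicit Types X : normedModType R.

Lemma functional_sum X (s : seq (dual X)) (c : dual X -> R) (x : X) :
  (\sum_(g <- s) c g *: g) x = \sum_(g <- s) c g * (g x : R) :> R.
Proof.
rewrite -[LHS]/(evalop x (\sum_(g <- s) c g *: g)) linear_sum.
by apply: eq_bigr => g _; rewrite linearZ.
Qed.

(** [r * `|g|] is the supremum of [g] on the ball of radius [r], also for
    [r = 0]. *)
Lemma functional_le X (g : dual X) (r M : R) : 0 <= r ->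
  (forall x, `|x| <= r -> (g x : R) <= M) -> r * `|g| <= M.
Proof.
rewrite le_eqVlt => /predU1P[<-|r0] gM.
  by rewrite mul0r; have := gM 0; rewrite normr0 linear0; apply.
rewrite -ler_pdivlMl//; apply: opnorm_le => x x1.
have rx : `|r *: x| <= r by rewrite normrZ gtr0_norm// ler_piMr// ltW.
rewrite ler_pdivlMl//; rewrite -[X in X * _](gtr0_norm r0) -normrZ -linearZ.
rewrite ler_norml; apply/andP; split; last exact: gM.
by rewrite lerNl -linearN; apply: gM; rewrite normrN.
Qed.

Theorem goldstine X (x2 : dual (dual X)) : exists U : set_system X,
  [/\ UltraFilter U, U [set x | `|x| <= `|x2|] &
      forall f : dual X, (f x : R) @[x --> U] --> (x2 f : R)].
Proof.
apply: (@helly_ultra R X (dual X) [set x | `|x| <= `|x2|]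
  (fun f x => f x) (fun f => x2 f)).
- by exists 0; rewrite /= normr0.
- move=> x y t /= xr yr /andP[t0 t1].
  have -> : x + t *: (y - x) = (1 - t) *: x + t *: y.
    by rewrite scalerBl scale1r scalerBr addrA addrAC.
  apply: le_trans (ler_normD _ _) _; rewrite !normrZ !ger0_norm ?subr_ge0//.
  have := ler_wpM2l t0 yr; have t1' : 0 <= 1 - t by rewrite subr_ge0.
  by have := ler_wpM2l t1' xr; lra.
- by move=> f a x y; rewrite linearP.
- move=> f; exists (`|f| * `|x2|) => x /= xr; apply: le_trans (le_opnorm _ _) _.
  exact: ler_wpM2l.
move=> s c M /= sM; set g := \sum_(i <- s) c i *: i.
have -> : \sum_(i <- s) c i * x2 i = x2 g.
  by rewrite linear_sum; apply: eq_bigr => i _; rewrite linearZ.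
apply: le_trans (ler_norm _) _; apply: le_trans (le_opnorm _ _) _.
by apply: functional_le => // x xr; rewrite functional_sum; exact: sM.
Qed.

(** Every functional of norm at most one on [linfty R] is a pointwise limit of
    elements of a convex set containing the coordinates and their opposites,
    in particular the unit ball of l^1 is weak* dense in that of its bidual. *)
Lemma linfty_dual_approx (B : set (dual (linfty R))) (phi : dual (linfty R)) :
  (forall n, B (coord n) /\ B (- coord n)) ->
  (forall mu, B mu -> `|mu| <= 1) ->
  (forall x y t, B x -> B y -> 0 <= t <= 1 -> B (x + t *: (y - x))) ->
  `|phi| <= 1 ->
  exists U : set_system (dual (linfty R)), [/\ UltraFilter U, U B &
      forall v : linfty R, (mu v : R) @[mu --> U] --> (phi v : R)].
Proof.
move=> Bcoord B1 convB phi1.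
apply: (@helly_ultra R (dual (linfty R)) (linfty R) B
  (fun v mu => mu v) (fun v => phi v)) => //.
- by exists (coord 0); have [] := Bcoord 0%N.
- move=> v; exists `|v| => mu Bmu; apply: le_trans (le_opnorm _ _) _.
  by rewrite ler_piMl// B1.
move=> s c M sM; set w := \sum_(i <- s) c i *: i.
have E (mu : dual (linfty R)) : \sum_(i <- s) c i * (mu i : R) = mu w.
  by rewrite linear_sum; apply: eq_bigr => i _; rewrite linearZ.
rewrite E; apply: le_trans (ler_norm _) _; apply: le_trans (le_opnorm _ _) _.
apply: (@le_trans _ _ `|w|); first by rewrite ler_piMl.
apply: linfty_norm_le => n; rewrite ler_norml; have [Bn BNn] := Bcoord n.
rewrite lerNl; apply/andP.
by split; [move: (sM _ BNn)|move: (sM _ Bn)]; rewrite E.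
Qed.

End goldstine.

(** * Weakly compact operators and their second adjoints *)

Section bitranspose.
Context {R : realType} {X Y : normedModType R} (T : boundedOp X Y)
  (x2 : dual (dual X)).

Fact bitranspose_linear : linear (fun phi : dual Y => x2 (opcomp phi T)).
Proof.
move=> a f g; rewrite -linearP; congr (x2 _).
exact: opP.
Qed.

Fact bitranspose_bounded :
  exists M, forall phi : dual Y, `|x2 (opcomp phi T)| <= M * `|phi|.
Proof.
exists (`|x2| * `|T|) => phi; apply: le_trans (le_opnorm _ _) _.
by rewrite -mulrA ler_wpM2l// mulrC opcomp_norm.
Qed.

(** the image of [x2] under the second adjoint of [T] *)
Definition bitranspose : dual (dual Y) :=
  mkop bitranspose_linear bitranspose_bounded.

Lemma bitransposeE phi : bitranspose phi = x2 (opcomp phi T).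
Proof. by []. Qed.

End bitranspose.

Section weak_compactness.
Context {R : realType}.
Implicit Types X Y : normedModType R.

(** The second adjoint of a weakly compact operator takes its values in the
    range space, not only in its bidual. *)
Lemma weakly_compact_bitranspose X Y (T : boundedOp X Y) :
  weakly_compact_ops X Y T ->
  forall x2 : dual (dual X), exists y, bitranspose T x2 = evalop y.
Proof.
move=> wT x2; have [U [UU Ux2 Uf]] := goldstine x2.
have rA : relatively_weakly_compact (T @` [set x | `|x| <= `|x2|]).
  by apply: wT; apply/bounded_setP; exists `|x2|.
have [|y Uy] := rwc_ultra_cvg rA (ultra_fmap T UU).
  by rewrite /fmap /=; apply: filterS Ux2 => x /= xx2; exists x.
exists y; apply: opP => phi; rewrite bitransposeE evalopE.
exact: cvg_unique (Uf (opcomp phi T)) (Uy phi).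
Qed.

Lemma weak_linfty_hausdorff : hausdorff_space (weak (linfty R)).
Proof.
apply: weak_hausdorff => u v uv; apply: linftyP => n.
exact: (uv (coord n)).
Qed.

(** The image of a ball of the bidual under the second adjoint is weakly
    compact as soon as it lies in [linfty R]. *)
Lemma bitranspose_weakly_compact X (T : boundedOp X (linfty R)) :
  (forall x2 : dual (dual X), exists y, bitranspose T x2 = evalop y) ->
  weakly_compact_ops X (linfty R) T.
Proof.
move=> TT A /bounded_setP[M AM].
pose K := [set y | exists2 x2, `|x2| <= M & bitranspose T x2 = evalop y].
apply: (@precompact_subset (weak (linfty R)) _ K).
  move=> _ [x Ax <-]; exists (evalop x); last exact: opP.
  exact: le_trans (evalop_norm x) (AM x Ax).
apply: (compact_precompact weak_linfty_hausdorff).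
rewrite compact_ultra => U UU UK.
have /choice[F FK] (y : linfty R) : exists x2 : dual (dual X), K y ->
    `|x2| <= M /\ bitranspose T x2 = evalop y.
  have [[x2 x2M x2y]|nK] := pselect (K y).
    by exists x2.
  by exists 0.
have FM : U [set y | `|F y| <= M] by apply: filterS UK => y /FK[].
have [x2 x2M Ux2] := ultralimit_functional UU FM.
have [y x2y] := TT x2; exists y; split; first by exists x2.
apply: weak_cvg => phi; rewrite -evalopE -x2y.
apply: cvg_trans (Ux2 (opcomp phi T)); apply: near_eq_cvg.
by apply: filterS UK => z /FK[_ zE]; rewrite -bitransposeE zE.
Qed.

(** The sequence [y] of the values of the second adjoint at the coordinates is
    the only candidate.  The functionals [mu] such that
    [bitranspose T x2 mu = mu y] contain the coordinates, hence approximate every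
    [phi] of norm at most one pointwise; by relative weak compactness the
    functionals [opcomp mu T] then approximate [opcomp phi T] weakly. *)
Lemma adjoint_rwc_bitranspose X (T : boundedOp X (linfty R)) :
  relatively_weakly_compact
    [set opcomp phi T | phi in [set phi : dual (linfty R) | `|phi| <= 1]] ->
  forall x2 : dual (dual X), exists y, bitranspose T x2 = evalop y.
Proof.
move=> rA x2.
have yP : (fun n => bitranspose T x2 (coord n)) \in @is_bounded_seq R.
  apply/is_bounded_seqP; exists `|bitranspose T x2| => n.
  by apply: le_trans (le_opnorm _ _) _; rewrite ler_piMr// coord_norm.
pose y : linfty R := Linfty yP; exists y.
suff unit phi : `|phi| <= 1 -> bitranspose T x2 phi = phi y.
  apply: opP => phi; rewrite evalopE.
  have p0 : 0 < 1 + `|phi| by rewrite ltr_pwDl.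
  have p1 : `|(1 + `|phi|)^-1 *: phi| <= 1.
    by rewrite normrZ gtr0_norm ?invr_gt0// ler_pdivrMl// mulr1 lerDr.
  have /eqP := unit _ p1; rewrite opZ scaleopE -subr_eq0 -scalerBr.
  by rewrite scaler_eq0 invr_eq0 (gt_eqF p0)/= subr_eq0 => /eqP.
move=> phi1.
pose B := [set mu : dual (linfty R) | `|mu| <= 1 /\ bitranspose T x2 mu = mu y].
have [||||U [UU UB Uphi]] := @linfty_dual_approx R B phi.
- move=> n; split; split=> //; rewrite ?normrN ?coord_norm//.
  by rewrite opN.
- by move=> mu [].
- move=> mu nu t [mu1 muy] [nu1 nuy] /andP[t0 t1]; split; last first.
    by rewrite !(opD, opZ, opN) !(addopE, scaleopE, oppopE) muy nuy.
  have -> : mu + t *: (nu - mu) = (1 - t) *: mu + t *: nu.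
    by rewrite scalerBl scale1r scalerBr addrA addrAC.
  apply: le_trans (ler_normD _ _) _; rewrite !normrZ !ger0_norm ?subr_ge0//.
  have := ler_wpM2l t0 nu1; have t1' : 0 <= 1 - t by rewrite subr_ge0.
  by have := ler_wpM2l t1' mu1; lra.
- by [].
have [|h Uh] := rwc_ultra_cvg rA (ultra_fmap (fun mu => opcomp mu T) UU).
  by rewrite /fmap /=; apply: filterS UB => mu [mu1 _]; exists mu.
have hE : h = opcomp phi T.
  by apply: opP => x; exact: cvg_unique (Uh (evalop x)) (Uphi (T x)).
have := Uh x2; rewrite hE => Ux2.
suff Uy : (x2 (opcomp mu T) : R) @[mu --> U] --> (phi y : R).
  exact: cvg_unique Ux2 Uy.
apply: cvg_trans (Uphi y); apply: near_eq_cvg.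
by apply: filterS UB => mu [_ <-].
Qed.

End weak_compactness.

(** * Failure of relative weak compactness *)

(** dependent choice in which each term is related to all the previous ones *)
Lemma choice_with_history (T : choiceType) (P : T -> Prop)
    (Q : T -> T -> Prop) :
  (forall s : seq T, {in s, forall z, P z} ->
    exists2 z, P z & {in s, forall w, Q w z}) ->
  exists u : nat -> T, (forall n, P (u n)) /\
    (forall m n, (m < n)%N -> Q (u m) (u n)).
Proof.
move=> step.
have /choice[F FP] (s : seq T) : exists z, {in s, forall z, P z} ->
    P z /\ {in s, forall w, Q w z}.
  have [sP|nP] := pselect {in s, forall z, P z}.
    by have [z Pz Qz] := step s sP; exists z.
  by have [z _ _] := step [::] (fun z => ltac:(by [])); exists z.
pose L := fix L n := if n is m.+1 then rcons (L m) (F (L m)) else [::].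
have LP n : {in L n, forall z, P z}.
  elim: n => // n IH z /=; rewrite mem_rcons inE.
  move=> /predU1P[->|]; last exact: IH.
  by have [] := FP _ IH.
exists (fun n => F (L n)); split=> [n|m n mn]; first by have [] := FP _ (LP n).
have [_] := FP _ (LP n); apply; elim: n mn => // n IH.
rewrite ltnS leq_eqVlt /= mem_rcons inE => /predU1P[->|/IH ->].
  by rewrite eqxx.
by rewrite orbT.
Qed.

Lemma filter_all_in (T : Type) (S : eqType) (F : set_system T) (s : seq S)
    (P : S -> set T) : Filter F ->
  {in s, forall z, F (P z)} -> F [set t | {in s, forall z, P z t}].
Proof.
move=> FF; elim: s => [_|z s IH zsP]; first exact: filterS filterT.
have Fz : F (P z) by apply: zsP; rewrite mem_head.
have Fs : F [set t | {in s, forall z, P z t}].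
  by apply: IH => w ws; apply: zsP; rewrite inE ws orbT.
apply: filterS (filterI Fz Fs) => t [zt st] w.
by rewrite inE => /predU1P[->//|]; exact: st.
Qed.

Section separation.
Context {R : realType} {X : normedModType R}.

Lemma weak_closure_bound (A : set (dual X)) (M : R) :
  (forall f, A f -> `|f| <= M) ->
  forall f, closure (A : set (weak (dual X))) f -> `|f| <= M.
Proof.
move=> AM f cf; apply: opnorm_le.
suff key x : `|x| <= 1 -> (f x : R) <= M.
  move=> x x1; rewrite ler_norml key// andbT lerNl -opN.
  by apply: key; rewrite normrN.
move=> x1; rewrite leNgt; apply/negP => Mfx.
have /cf[h [Ah /= Mh]] :
    nbhs (f : weak (dual X)) [set h : weak (dual X) | M < evalop x h].
  exact: open_nbhs_nbhs (conj (@weak_open_gt _ _ (evalop x) M) Mfx).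
have := lt_le_trans Mh (ler_norm _); rewrite ltNge => /negP; apply.
apply: le_trans (le_opnorm _ _) _.
by apply: (@le_trans _ _ `|h|); [rewrite ler_piMr|exact: AM].
Qed.

(** A bounded set of functionals that is not relatively weakly compact fails
    the interchange of limits against a bounded sequence of vectors. *)
Lemma not_rwc_separation (A : set (dual X)) : bounded_set A ->
  ~ relatively_weakly_compact A ->
  exists (f : nat -> dual X) (x : nat -> X) (r a b : R),
    [/\ forall n, A (f n), forall n, `|x n| <= r, a < b,
        forall m n, (m < n)%N -> (f n (x m) : R) < a &
        forall m n, (n <= m)%N -> b < (f n (x m) : R)].
Proof.
move=> /bounded_setP[M AM] nA.
have [U [UU UA nU]] : exists U : set_system (dual X), [/\ UltraFilter U,
    U (closure (A : set (weak (dual X)))) &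
    forall g : dual X, ~ forall x2 : dual (dual X),
      (x2 f : R) @[f --> U] --> (x2 g : R)].
  apply: contrapT => nU; apply: nA.
  rewrite /relatively_weakly_compact precompactE compact_ultra => U UU UA.
  apply: contrapT => nUA; apply: nU; exists U; split=> // g Ug; apply: nUA.
  have Uwg : U --> (g : weak (dual X)) by exact: weak_cvg.
  exists g; split=> //; apply: (@closed_closure (weak (dual X))) => B Bg.
  by apply: (@filter_ex _ U); apply: filterI => //; exact: Uwg.
(* [U] converges pointwise on [X] to some [g], but not weakly: the limit [be] of
   some [x2] along [U] differs from [x2 g] *)
have cAM := weak_closure_bound AM.
have UM : U [set f | `|f| <= M] by apply: filterS UA => f /cAM.
have [g _ Ug] := ultralimit_functional UU UM.
have [x2 [be Ux2 gbe]] : exists (x2 : dual (dual X)), exists2 be : R,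
    (x2 f : R) @[f --> U] --> be & (x2 g : R) < be.
  have /existsNP[x2 nx2] := nU g.
  have Ux2M : U [set f | `|x2 f : R| <= `|x2| * M].
    apply: filterS UM => f /= fM; apply: le_trans (le_opnorm _ _) _.
    exact: ler_wpM2l.
  have [be Ube] := ultra_bounded_cvg UU Ux2M.
  have [gb|bg|gb] := ltgtP (x2 g : R) be; first by exists x2, be.
    exists (- x2), (- be); last by rewrite oppopE ltrN2.
    exact: cvgN.
  by case: nx2; rewrite gb.
pose a := (2 * (x2 g : R) + be) / 3; pose b := ((x2 g : R) + 2 * be) / 3.
have ga : (x2 g : R) < a by rewrite /a; lra.
have ab : a < b by rewrite /a /b; lra.
have bbe : b < be by rewrite /b; lra.
have [V [VV Vr Vf]] := goldstine x2.
(* [f n] is chosen close to [g] on the previous vectors while [x2 (f n)] stays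
   close to [be]; then [x n] is chosen close to [x2] on [g] and on the previous
   functionals *)
pose P (z : dual X * X) := [/\ A z.1, b < (x2 z.1 : R), `|z.2| <= `|x2|,
  (g z.2 : R) < a & b < (z.1 z.2 : R)].
pose Q (w z : dual X * X) := (z.1 w.2 : R) < a /\ b < (w.1 z.2 : R).
have [s sP|u [uP uQ]] := @choice_with_history _ P Q.
  have Ua : U [set f | {in s, forall w, (f w.2 : R) < a}].
    apply: filter_all_in => w /sP[_ _ _ gw _].
    have := Ug w.2 => /(_ [set y | y < a]); apply; exact: lt_nbhsl.
  have Ub : U [set f | b < (x2 f : R)].
    by have := Ux2 => /(_ [set y | b < y]); apply; exact: lt_nbhsr.
  (* [f0] lies in the weak closure of [A] only; the conditions on it are finitely
     many and weakly open, hence they are met in [A] *)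
  have [f0 [f0s [/= bf0 f0A]]] := filter_ex (filterI Ua (filterI Ub UA)).
  have na : nbhs (f0 : weak (dual X))
      [set f : weak (dual X) | {in s, forall w, ((f : dual X) w.2 : R) < a}].
    apply: (@filter_all_in _ _ (nbhs (f0 : weak (dual X))) s
      (fun w => [set f : weak (dual X) | ((f : dual X) w.2 : R) < a])).
    move=> w ws; apply: open_nbhs_nbhs; split; last exact: f0s.
    exact: (@weak_open_lt _ _ (evalop w.2) a).
  have nb := open_nbhs_nbhs (conj (@weak_open_gt _ _ x2 b) bf0).
  have [f [Af [fs bf]]] := f0A _ (filterI na nb).
  have Vs : V [set x | {in s, forall w : dual X * X, b < (w.1 x : R)}].
    apply: filter_all_in => w /sP[_ bw _ _ _].
    by have := Vf w.1 => /(_ [set y | b < y]); apply; exact: lt_nbhsr.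
  have Va : V [set x | (g x : R) < a].
    by have := Vf g => /(_ [set y | y < a]); apply; exact: lt_nbhsl.
  have Vb : V [set x | b < ((f : dual X) x : R)].
    by have := Vf f => /(_ [set y | b < y]); apply; exact: lt_nbhsr.
  have [x [xs [/= xr [xa xb]]]] :=
    filter_ex (filterI Vs (filterI Vr (filterI Va Vb))).
  by exists (f, x) => // w ws; split; [exact: fs|exact: xs].
exists (fun n => (u n).1), (fun n => (u n).2), `|x2|, a, b; split=> //.
- by move=> n; have [] := uP n.
- by move=> n; have [] := uP n.
- by move=> m n /uQ[].
- move=> m n; rewrite leq_eqVlt => /predU1P[->|/uQ[]//].
  by have [] := uP m.
Qed.

End separation.

Section weakly_compact_linfty.
Context {R : realType} {X : normedModType R}.
Variable T : boundedOp X (linfty R).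
Hypothesis wT : weakly_compact_ops X (linfty R) T.

(** Limits along the vectors and along the coordinates can be interchanged for
    a weakly compact operator. *)
Lemma weakly_compact_interchange (x : nat -> X) (r a b : R) (I : set nat) :
  (forall m, `|x m| <= r) -> (forall n, exists2 m, (n <= m)%N & I m) ->
  (forall m n, (m < n)%N -> I n -> T (x m) n <= a) ->
  (forall m n, (n <= m)%N -> I n -> b <= T (x m) n) -> b <= a.
Proof.
move=> xr Iinf xa xb; have [V [VV sV VI]] := infinite_ultra Iinf.
have rx : relatively_weakly_compact (T @` range x).
  by apply: wT; apply/bounded_setP; exists r => _ [m _ <-].
have [|y Vy] := rwc_ultra_cvg rx (ultra_fmap (fun m => T (x m)) VV).
  by rewrite /fmap /=; apply: filterS VI => m _; exists (x m) => //; exists m.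
have [|phi _ Vphi] := @ultralimit_functional _ _ _ _ (@coord R) 1 VV.
  by apply: filterS VI => n _; exact: coord_norm.
have tail m : V [set n | (m <= n)%N] by apply: sV; exists m.
have phia m : (phi (T (x m)) : R) <= a.
  have le_a : V [set n | (coord n (T (x m)) : R) <= a].
    by apply: filterS (filterI (tail m.+1) VI) => n [mn In]; exact: xa.
  exact: (cvgr_to_le (Vphi (T (x m))) le_a).
have ya : (phi y : R) <= a.
  have le_a : V [set m | (phi (T (x m)) : R) <= a].
    by apply: filterS VI => m _; exact: phia.
  exact: (cvgr_to_le (Vy phi) le_a).
have yb n : I n -> b <= (coord n y : R).
  move=> In; have ge_b : V [set m | b <= (coord n (T (x m)) : R)].
    by apply: filterS (tail n) => m nm; exact: xb.
  exact: (cvgr_to_ge (Vy (coord n)) ge_b).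
apply: le_trans ya; have ge_b : V [set n | b <= (coord n y : R)].
  by apply: filterS VI => n; exact: yb.
exact: (cvgr_to_ge (Vphi y) ge_b).
Qed.

End weakly_compact_linfty.

(** * Weakly compact operators are Dunford-Pettis completely continuous *)

Lemma exists_natSinv_lt (R : realType) (e : R) : 0 < e ->
  exists K, forall n, (K <= n)%N -> n.+1%:R^-1 < e.
Proof.
move=> e0; have [K _ KP] := @near_infty_natSinv_lt R (PosNum e0).
by exists K => n; exact: KP.
Qed.

(** Countably many points of [B] approximate every point of [B] with respect to
    finitely many of the functions [f n]. *)
Lemma countable_approx (R : realType) (X : Type) (f : nat -> X -> R)
    (B : set X) :
  B !=set0 -> exists d : nat -> X, (forall j, B (d j)) /\
    forall x, B x -> forall N (e : R), 0 < e ->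
      exists j, forall n, (n < N)%N -> `|f n (d j) - f n x| < e.
Proof.
move=> [z0 Bz0].
pose C (p : nat * seq rat) z :=
  forall n, (n < size p.2)%N -> `|f n z - ratr (nth 0 p.2 n)| < p.1.+1%:R^-1.
have /choice[z zP] (p : nat * seq rat) :
    exists z, B z /\ ((exists2 w, B w & C p w) -> C p z).
  have [[w Bw Cw]|nC] := pselect (exists2 w, B w & C p w); first by exists w.
  by exists z0.
exists (fun j => if unpickle j is Some p then z p else z0).
split=> [j|x Bx N e e0].
  by case: unpickle => // p; have [] := zP p.
have e2 : 0 < e / 2 by lra.
have [k /(_ k (leqnn k)) k0] := exists_natSinv_lt e2.
have k1 : 0 < k.+1%:R^-1 :> R by rewrite invr_gt0.
have rat_near (c y : R) : 0 < c -> exists q, `|y - ratr q| < c.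
  move=> c0; have /rat_in_itvoo[q] : y - c < y + c by lra.
  rewrite in_itv/= => /andP[q1 q2]; exists q.
  by rewrite ltr_norml; apply/andP; split; lra.
have /choice[q qP] n : exists q, `|f n x - ratr q| < k.+1%:R^-1.
  exact: rat_near.
have [_ zC] := zP (k, mkseq q N).
exists (pickle (k, mkseq q N)) => n nN; rewrite pickleK.
have h1 : `|f n (z (k, mkseq q N)) - ratr (q n)| < k.+1%:R^-1.
  have /zC/(_ n) : exists2 w, B w & C (k, mkseq q N) w.
    by exists x => // m; rewrite /= size_mkseq => mN; rewrite nth_mkseq.
  by rewrite /= size_mkseq nth_mkseq//; exact.
have h2 := qP n; rewrite distrC in h2.
apply: le_lt_trans (ler_distD (ratr (q n)) _ _) _.
by rewrite (splitr e) ltrD// (lt_trans _ k0).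
Qed.

Section weakly_compact_DPcc.
Context {R : realType} {X : normedModType R}.
Variable T : boundedOp X (linfty R).
Hypothesis wT : weakly_compact_ops X (linfty R) T.

(** Countably many vectors determine the adjoint of [T]: every vector [x] of
    the unit ball has a sequence of them whose images converge to [T x] coordinate
    by coordinate, and [T x] is then a weak cluster point of these images. *)
Lemma weakly_compact_determined : exists d : nat -> X,
  forall phi psi : dual (linfty R), (forall j, phi (T (d j)) = psi (T (d j))) ->
    opcomp phi T = opcomp psi T.
Proof.
have [|d [d1 dP]] := @countable_approx R X (fun n x => T x n)
  [set x | `|x| <= 1].
  by exists 0; rewrite /= normr0.
exists d => phi psi pp; suff key x : `|x| <= 1 -> phi (T x) = psi (T x).
  apply/eqP; rewrite -subr_eq0 -normr_le0; apply: opnorm_le => x x1.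
  by rewrite addopE oppopE !opcompE key// subrr normr0.
move=> x1; have /choice[j jP] (N : nat) : exists j, forall n, (n < N)%N ->
    `|T (d j) n - T x n| < N.+1%:R^-1.
  by apply: dP => //; rewrite invr_gt0.
have [n|U [UU sU _]] := @infinite_ultra setT; first by exists n.
have rd : relatively_weakly_compact (T @` range d).
  by apply: wT; apply/bounded_setP; exists 1 => _ [m _ <-]; exact: d1.
have [|y Uy] := rwc_ultra_cvg rd (ultra_fmap (fun N => T (d (j N))) UU).
  by rewrite /fmap /=; apply: filterS filterT => N _; exists (d (j N)).
have yE : y = T x.
  apply: linftyP => n; apply: (cvg_unique _ (Uy (coord n))) => //=.
  apply: (@cvg_trans _ (T (d (j N)) n @[N --> \oo])).
    by move=> A; exact: sU.
  apply/cvgrPdist_lt => e e0.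
  have [K KP] := exists_natSinv_lt e0; exists (maxn n.+1 K) => // N /=.
  rewrite geq_max => /andP[nN KN].
  by rewrite distrC; apply: lt_trans (jP N n nN) (KP N KN).
have Uphi : (phi (T (d (j N))) : R) @[N --> U] --> (phi y : R) := Uy phi.
rewrite (_ : (fun N => _) = (fun N => psi (T (d (j N))) : R)) in Uphi.
  by rewrite -yE; exact: cvg_unique Uphi (Uy psi).
by apply/funext => N; exact: pp.
Qed.

(** Every sequence of coordinates of a weakly compact operator has a weakly
    convergent subsequence in the dual. *)
Lemma weakly_compact_coord_subseq (i : nat -> nat) :
  exists (k : nat -> nat) (f : dual X), (forall m, (m <= k m)%N) /\
    weakly_null (fun m => opcomp (coord (i (k m))) T - f).
Proof.
have [d dP] := weakly_compact_determined.
have [n|U [UU sU _]] := @infinite_ultra setT; first by exists n.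
have lim (s : nat -> nat) (V : set_system nat) : UltraFilter V ->
    exists phi : dual (linfty R),
      forall v : linfty R, v (s m) @[m --> V] --> (phi v : R).
  move=> VV.
  have [|phi _ Vphi] :=
    @ultralimit_functional _ _ _ _ (fun m => @coord R (s m)) 1 VV.
    by apply: filterS filterT => m _; exact: coord_norm.
  by exists phi.
have [phi Uphi] := lim i U UU.
(* the diagonal extraction: the coordinates [i (k m)] converge to [phi] at each
   of the vectors [T (d j)] *)
have /choice[k kP] (m : nat) : exists k, (m <= k)%N /\
    forall j, (j <= m)%N -> `|phi (T (d j)) - T (d j) (i k)| < m.+1%:R^-1.
  have Um : U [set k | (m <= k)%N] by apply: sU; exists m.
  have Uj : U [set k | {in iota 0 m.+1, forall j,
      `|phi (T (d j)) - T (d j) (i k)| < m.+1%:R^-1}].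
    apply: filter_all_in => j _.
    have /cvgrPdist_lt := Uphi (T (d j)).
    by apply; rewrite invr_gt0.
  have [k' [mk kj]] := filter_ex (filterI Um Uj); exists k'; split=> // j jm.
  by apply: kj; rewrite mem_iota.
exists k, (opcomp phi T); split=> [m|]; first by have [] := kP m.
apply/weakly_nullP => x2.
have [y yE] := weakly_compact_bitranspose wT x2.
have x2E (psi : dual (linfty R)) : x2 (opcomp psi T) = psi y.
  by rewrite -bitransposeE yE.
suff : y (i (k m)) @[m --> \oo] --> (phi y : R).
  move=> yk; under eq_fun do rewrite opD opN !x2E.
  rewrite -(subrr (phi y : R)); apply: cvgB => //; exact: cvg_cst.
apply: cvg_ultraP => W WW sW; have [psi Wpsi] := lim (i \o k) W WW.
suff -> : phi y = psi y by exact: Wpsi.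
(* any limit [psi] of the subsequence agrees with [phi] on the [T (d j)], hence
   on the range of [T] *)
rewrite -!x2E; congr (x2 _); apply: dP => j.
apply: (cvg_unique _ _ (Wpsi (T (d j)))) => //.
apply: (@cvg_trans _ (T (d j) (i (k m)) @[m --> \oo])).
  by move=> A; exact: sW.
apply/cvgrPdist_lt => e e0.
have [K KP] := exists_natSinv_lt e0; exists (maxn j K) => // N /=.
rewrite geq_max => /andP[jN KN].
by have [_ /(_ j jN) h] := kP N; apply: lt_trans h (KP N KN).
Qed.

Lemma weakly_compact_DPcc : DPcc_ops X (linfty R) T.
Proof.
move=> x x0 [/bounded_setP[M xM] DPx]; apply: contrapT => nTx.
have [e e0 /choice[g gP]] : exists2 e : R, 0 < e & forall N,
    exists n, (N <= n)%N /\ e <= `|T (x n)|.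
  apply: contrapT => ne; apply: nTx; apply/cvgr0Pnorm_lt => e e0.
  apply: contrapT => nN; apply: ne; exists e => // N.
  apply: contrapT => nn; apply: nN; exists N => // n /= Nn.
  by rewrite ltNge; apply/negP => en; apply: nn; exists n.
have /choice[i iP] (k : nat) : exists i, e / 2 < `|T (x (g k)) i|.
  apply: contrapT => ni; have [_] := gP k; apply/negP; rewrite -ltNge.
  apply: (@le_lt_trans _ _ (e / 2)); last by lra.
  apply: linfty_norm_le => i; rewrite leNgt; apply/negP => ei.
  by apply: ni; exists i.
have [k [f [km hf]]] := weakly_compact_coord_subseq i.
have /cvgr0Pnorm_lt/(_ (e / 4)) := DPx _ hf.
have e4 : 0 < e / 4 by lra.
move=> /(_ e4)[N1 _ N1P].
move/weakly_nullP : x0 => /(_ f)/cvgr0Pnorm_lt/(_ _ e4)[N2 _ N2P].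
pose m := maxn N1 N2; pose n := g (k m).
have n2 : (N2 <= n)%N.
  have [h _] := gP (k m); apply: leq_trans h; apply: leq_trans (km m).
  exact: leq_maxr.
have {N1P} := N1P m (leq_maxl _ _); have {N2P} := N2P n n2; have := iP (k m).
set F := opcomp _ _ - f => h1 h2 h3.
have h4 : `|F (x n) : R| < e / 4.
  apply: le_lt_trans h3; apply: le_trans (ler_norm _).
  apply: sup_upper_bound; last by exists (x n) => //; exists n.
  split; first by exists `|F (x 0) : R|, (x 0) => //; exists 0%N.
  exists (`|F| * M) => _ [_ [p _ <-] <-]; apply: le_trans (le_opnorm _ _) _.
  by rewrite ler_wpM2l// xM.
have : `|T (x n) (i (k m))| <= `|F (x n) : R| + `|f (x n) : R|.
  apply: le_trans (ler_normD _ _); rewrite [F _]addopE oppopE opcompE.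
  by rewrite [coord _ _]coordE subrK.
by move: h1 h2 h4; rewrite /= -/n; lra.
Qed.

End weakly_compact_DPcc.

(** * Almost disjoint sets of indices *)

Section almost_disjoint.
Context {R : realType}.

Fact chi_bounded (A : set nat) : \1_A \in @is_bounded_seq R.
Proof.
apply/is_bounded_seqP; exists 1 => n; rewrite indicE ger0_norm//.
by rewrite lern1 leq_b1.
Qed.

(** the indicator function of [A] *)
Definition chi (A : set nat) : linfty R := Linfty (chi_bounded A).

Lemma chiE A n : chi A n = (n \in A)%:R. Proof. by rewrite -indicE. Qed.

Lemma chi1E i n : chi [set i] n = (n == i)%:R.
Proof. by rewrite chiE classical_sets.in_set1. Qed.

Lemma linfty_sum (I : Type) (s : seq I) (v : I -> linfty R) n :
  (\sum_(i <- s) v i) n = \sum_(i <- s) v i n :> R.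
Proof. exact: (linear_sum (coord n)). Qed.

Section vanishing.
Variable psi : dual (linfty R).
Hypothesis psi0 : forall n, psi (chi [set n]) = 0.

Lemma vanishing_tail N (v : linfty R) :
  (forall n, (N <= n)%N -> v n = 0) -> psi v = 0.
Proof.
move=> v0; have -> : v = \sum_(0 <= i < N) v i *: chi [set i].
  apply: linftyP => n; rewrite linfty_sum.
  under eq_bigr do rewrite scale_linftyE chi1E.
  have [nN|Nn] := ltnP n N.
    rewrite (bigD1_seq n) ?iota_uniq ?mem_index_iota//= eqxx mulr1.
    rewrite big1 ?addr0//.
    by move=> i iN; rewrite eq_sym (negPf iN) mulr0.
  rewrite v0// big_nat big1// => i /andP[_ iN].
  by rewrite gtn_eqF ?mulr0// (leq_trans iN).
rewrite linear_sum big1// => i _.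
by rewrite [LHS]opZ psi0 scaler0.
Qed.

(** A functional vanishing on the coordinate unit vectors only sees the tails. *)
Lemma vanishing_le N (v : linfty R) :
  (forall n, (N <= n)%N -> `|v n| <= 1) -> `|psi v| <= `|psi|.
Proof.
move=> v1; pose w n := if (n < N)%N then 0 else v n.
have wP : w \in @is_bounded_seq R.
  apply/is_bounded_seqP; exists 1 => n; rewrite /w; case: ltnP => [_|/v1//].
  by rewrite normr0.
have -> : psi v = psi (Linfty wP).
  apply/eqP; rewrite -subr_eq0 -opN -opD; apply/eqP.
  apply: (@vanishing_tail N) => n Nn.
  by rewrite add_linftyE opp_linftyE /= /w ltnNge Nn subrr.
apply: le_trans (le_opnorm _ _) _; rewrite ler_piMr//.
apply: linfty_norm_le => n; rewrite /= /w; case: ltnP => [_|/v1//].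
by rewrite normr0.
Qed.

End vanishing.

(** the codes of the finite prefixes of [b]: distinct branches of the binary
    tree have finitely many common prefixes *)
Definition branch (b : nat -> bool) : set nat :=
  range (fun n => pickle (mkseq b n)).

Lemma branch_unbounded b n : exists2 m, (n <= m)%N & branch b m.
Proof.
apply: contrapT => nb.
pose s := [seq pickle (mkseq b i) | i <- iota 0 n.+1].
have us : uniq s.
  rewrite map_inj_uniq ?iota_uniq// => i j /(pcan_inj pickleK)/(congr1 size).
  by rewrite !size_mkseq.
suff /(uniq_leq_size us) : {subset s <= iota 0 n}.
  by rewrite size_map !size_iota ltnn.
move=> _ /mapP[i _ ->]; rewrite mem_iota/= ltnNge; apply/negP => ni.
by apply: nb; exists (pickle (mkseq b i)) => //; exists i.
Qed.

Lemma branch_almost_disjoint b c : b != c ->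
  exists N, forall n, (N <= n)%N -> branch b n -> ~ branch c n.
Proof.
move=> bc; have [k bck] : exists k, b k <> c k.
  by apply/existsNP => E; move/eqP : bc; apply; exact: funext.
exists (\max_(i < k.+1) pickle (mkseq b i)).+1 => n nk [i _ bi] [j _ cj].
have := cj; rewrite -bi => /(pcan_inj pickleK) E.
have ij : j = i by rewrite -(size_mkseq c j) E size_mkseq.
have [ik|ki] := ltnP i k.+1.
  have := leq_bigmax (Ordinal ik) (F := fun i : 'I_k.+1 => pickle (mkseq b i)).
  by rewrite /= bi => /(leq_trans nk); rewrite ltnn.
apply: bck; have := congr1 (fun s => nth false s k) E.
by rewrite ij !nth_mkseq.
Qed.

(** Beyond some index, at most one of finitely many branches contains a given
    code. *)
Lemma branch_sum_le1 (s : seq (nat -> bool)) : uniq s ->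
  exists N, forall n, (N <= n)%N -> \sum_(b <- s) chi (branch b) n <= 1.
Proof.
elim: s => [_|b s IH]; first by exists 0%N => n _; rewrite big_nil.
rewrite cons_uniq => /andP[bs /IH[N1 N1P]].
have [N2 _ N2P] : (\forall n \near \oo,
    {in s, forall c, branch b n -> ~ branch c n}).
  apply: (@filter_all_in _ _ _ s
    (fun c n => branch b n -> ~ branch c n)) => c cs.
  have [|N NP] := @branch_almost_disjoint b c; last by exists N.
  by apply: contraNneq bs => ->.
exists (maxn N1 N2) => n; rewrite geq_max => /andP[n1 n2]; rewrite big_cons.
have [bn|bn] := pselect (branch b n); last first.
  by rewrite chiE memNset// add0r N1P.
rewrite big_seq big1 ?addr0; first by rewrite chiE lern1 leq_b1.
by move=> c cs; rewrite chiE memNset//; exact: (N2P n n2 c cs).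
Qed.

(** A combination with signs of the indicator functions of finitely many branches
    is bounded by one beyond some index, so that at most [`|psi| / e] branches
    belong to this set. *)
Lemma finite_branch_large (psi : dual (linfty R)) (e : R) :
  (forall n, psi (chi [set n]) = 0) -> 0 < e ->
  finite_set [set b | e <= `|psi (chi (branch b)) : R|].
Proof.
move=> psi0 e0; apply: contrapT.
pose n := (Num.truncn (`|psi| / e)).+1.
move=> /(infinite_set_fset n)[B Be nB].
pose s : seq (nat -> bool) := finmap.enum_fset B.
have [N NP] := branch_sum_le1 (finmap.fset_uniq B : uniq s).
pose v := \sum_(b <- s) Num.sg (psi (chi (branch b)) : R) *: chi (branch b).
have : `|psi v : R| <= `|psi|.
  apply: (vanishing_le psi0 (N := N)) => m Nm; rewrite linfty_sum.
  apply: le_trans (NP m Nm); apply: le_trans (ler_norm_sum _ _ _) _.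
  apply: ler_sum => b _; rewrite scale_linftyE normrM normr_sg chiE ger0_norm//.
  by rewrite ler_piMl// lern1 leq_b1.
have -> : psi v = \sum_(b <- s) `|psi (chi (branch b)) : R| :> R.
  rewrite linear_sum; apply: eq_bigr => b _.
  by rewrite [LHS]opZ [RHS]normrEsg.
move=> /(le_trans (ler_norm _)); apply/negP; rewrite -ltNge.
apply: (@lt_le_trans _ _ (\sum_(b <- s) e)).
  rewrite big_const_seq count_predT iter_addr_0 -mulr_natl -ltr_pdivrMr//.
  apply: lt_le_trans (truncnS_gt _) _.
  by rewrite ler_nat.
by rewrite big_seq [leRHS]big_seq; apply: ler_sum => b; exact: Be.
Qed.

Lemma uncountable_cantor (A : set (nat -> bool)) :
  countable A -> exists b, ~ A b.
Proof.
move=> /countable_injP[f finj]; apply: contrapT => /forallNP AT.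
have {}AT b : b \in A by rewrite inE; apply: contrapT; exact: AT.
pose c n := `[< exists2 b, f b = n & b n = false >].
have [cc|cc] := boolP (c (f c)).
  move: (cc) => /asboolP[b /(finj _ _ (AT b) (AT c)) bc].
  by rewrite bc cc.
by move: (cc) => /asboolPn; apply; exists c => //; exact: negbTE.
Qed.

(** Countably many functionals that vanish on the coordinate unit vectors vanish
    together on the indicator function of some infinite set: each of them is
    nonzero on countably many of the uncountably many branches only. *)
Lemma vanishing_on_infinite_set (J : countType) (psi : J -> dual (linfty R)) :
  (forall j n, psi j (chi [set n]) = 0) ->
  exists I : set nat, (forall n, exists2 m, (n <= m)%N & I m) /\
    forall j, psi j (chi I) = 0.
Proof.
move=> psi0.
pose S (j : J) (k : nat) :=
  [set b | k.+1%:R^-1 <= `|psi j (chi (branch b)) : R|].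
have /uncountable_cantor[b nb] : countable (\bigcup_j \bigcup_k S j k).
  apply: bigcup_countable => // j _; apply: bigcup_countable => // k _.
  apply: finite_set_countable; apply: finite_branch_large; first exact: psi0.
  by rewrite invr_gt0.
exists (branch b); split=> [n|j]; first exact: branch_unbounded.
apply/eqP; rewrite -normr_le0 leNgt; apply/negP => /exists_natSinv_lt[k].
move=> /(_ k (leqnn k)) kb; apply: nb; exists j => //; exists k => //=.
exact: ltW.
Qed.

End almost_disjoint.

(** * Diagonal operators *)

Section diagonal.
Context {R : realType} {X : normedModType R}.
Variables (f : nat -> dual X) (C : R).
Hypothesis fC : forall n, `|f n| <= C.

Lemma diag_le (u : linfty R) x n : `|u n * (f n x : R)| <= `|u| * C * `|x|.
Proof.
rewrite normrM -mulrA; apply: ler_pM => //; first exact: linfty_norm_ge.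
by apply: le_trans (le_opnorm _ _) _; rewrite ler_wpM2r.
Qed.

Fact diag_bounded (u : linfty R) x :
  (fun n => u n * (f n x : R)) \in @is_bounded_seq R.
Proof.
by apply/is_bounded_seqP; exists (`|u| * C * `|x|) => n; exact: diag_le.
Qed.

Fact diag_linear (u : linfty R) : linear (fun x => Linfty (diag_bounded u x)).
Proof.
move=> a x y; apply: linftyP => n.
rewrite add_linftyE scale_linftyE /= linearP.
by rewrite mulrDr mulrCA.
Qed.

Fact diag_op_bounded (u : linfty R) :
  exists M, forall x, `|Linfty (diag_bounded u x)| <= M * `|x|.
Proof.
by exists (`|u| * C) => x; apply: linfty_norm_le => n; exact: diag_le.
Qed.

(** the operator that maps [x] to the sequence of the [u n * f n x] *)
Definition diagop (u : linfty R) : boundedOp X (linfty R) :=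
  mkop (diag_linear u) (diag_op_bounded u).

Lemma diagopE u x n : diagop u x n = u n * (f n x : R). Proof. by []. Qed.

Lemma diagop_linear a u v : diagop (a *: u + v) = a *: diagop u + diagop v.
Proof.
apply: opP => x; apply: linftyP => n; rewrite addopE scaleopE.
rewrite !(add_linftyE, scale_linftyE, diagopE).
by rewrite mulrDl mulrA.
Qed.

Lemma diagop_norm u : `|diagop u| <= `|u| * C.
Proof.
have C0 : 0 <= C := le_trans (normr_ge0 _) (fC 0%N).
apply: opnorm_le => x x1; apply: (@le_trans _ _ (`|u| * C * `|x|)).
  by apply: linfty_norm_le => n; exact: diag_le.
by rewrite ler_piMr// mulr_ge0.
Qed.

Lemma diagop_unit_weakly_compact n :
  weakly_compact_ops X (linfty R) (diagop (chi [set n])).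
Proof.
apply: bitranspose_weakly_compact => x2.
exists ((x2 (f n) : R) *: chi [set n]); apply: opP => phi.
rewrite bitransposeE evalopE opZ.
have -> : opcomp phi (diagop (chi [set n])) = (phi (chi [set n]) : R) *: f n.
  apply: opP => x; rewrite opcompE scaleopE.
  have -> : diagop (chi [set n]) x = (f n x : R) *: chi [set n].
    apply: linftyP => m; rewrite scale_linftyE diagopE chi1E.
    by case: eqP => [->|_]; rewrite ?mul1r ?mulr1 ?mul0r ?mulr0.
  by rewrite opZ; exact: mulrC.
by rewrite opZ; exact: mulrC.
Qed.

Lemma diagop_DPcc (A : set (dual X)) u :
  L_DP_set A -> (forall n, A (f n)) -> DPcc_ops X (linfty R) (diagop u).
Proof.
move=> [/bounded_setP[M AM] LA] Af x x0 DPx.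
apply/cvgr0Pnorm_lt => e e0.
have u1 : 0 < `|u| + 1 by rewrite ltr_pwDr.
have /cvgr0Pnorm_lt/(_ (e / (`|u| + 1))) := LA x x0 DPx.
rewrite divr_gt0// => /(_ isT) [N _ NP]; exists N => // k /= /NP{NP} ke.
apply: (@le_lt_trans _ _ (`|u| * (e / (`|u| + 1)))); last first.
  by rewrite mulrCA gtr_pMr// ltr_pdivrMr// mul1r ltrDl.
apply: linfty_norm_le => n; rewrite [diagop u _ _]diagopE normrM.
apply: ler_pM => //; first exact: linfty_norm_ge.
apply: le_trans (ltW ke); apply: le_trans (ler_norm _).
apply: sup_upper_bound; last by exists (f n).
split; first by exists `|f 0%N (x k) : R|, (f 0%N).
exists (M * `|x k|) => _ [g Ag <-]; apply: le_trans (le_opnorm _ _) _.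
by rewrite ler_wpM2r// AM.
Qed.

End diagonal.

(** * The three properties *)

Section equivalence.
Context {R : realType} {X : normedModType R}.
Local Notation W := (weakly_compact_ops X (linfty R)).
Local Notation DP := (DPcc_ops X (linfty R)).

Lemma L_DP_property_weakly_compactE : L_DP_property X -> W = DP.
Proof.
move=> LDP; apply/seteqP; split=> T; first exact: weakly_compact_DPcc.
move=> DT; apply: bitranspose_weakly_compact; apply: adjoint_rwc_bitranspose.
apply: LDP; split.
  apply/bounded_setP; exists `|T| => _ [phi /= phi1 <-].
  by apply: le_trans (opcomp_norm _ _) _; rewrite ler_piMl.
move=> x x0 DPx; have /cvgr0Pnorm_lt Tx0 := DT x x0 DPx.
apply/cvgr0Pnorm_lt => e /Tx0[N _ NP]; exists N => // n /= /NP{NP} ne.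
set S := (X in sup X).
have Sle y : S y -> y <= `|T (x n)|.
  move=> [_ [phi /= phi1 <-] <-]; rewrite opcompE.
  by apply: le_trans (le_opnorm _ _) _; rewrite ler_piMl.
have S0 : S `|opcomp (coord 0) T (x n)|.
  exists (opcomp (coord 0) T) => //; exists (coord 0) => //; exact: coord_norm.
have supS : has_sup S.
  by split; [exists `|opcomp (coord 0) T (x n)| | exists `|T (x n)|].
apply: le_lt_trans ne; rewrite ger0_norm; first exact: ge_sup supS.1 Sle.
by apply: le_trans (sup_upper_bound supS S0); exact: normr_ge0.
Qed.

Lemma complemented_L_DP_property : complemented_in W DP -> L_DP_property X.
Proof.
move=> [sWD [P [Plin [M PM] PW PP]]] A LA; apply: contrapT => nA.
have [/[dup] bA /bounded_setP[C AC] _] := LA.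
have [f [x [r [a [b [Af xr ab fa fb]]]]]] := not_rwc_separation bA nA.
have fC n : `|f n| <= C by apply: AC; exact: Af.
pose T := diagop fC.
have DT u : DP (T u) by exact: diagop_DPcc LA Af.
have PE S : W S -> P S = S by rewrite -PW => -[S' DS' <-]; exact: PP.
pose Q u := P (T u) - T u.
have Qlin c u v : Q (c *: u + v) = c *: Q u + Q v.
  rewrite /Q /T diagop_linear -/T Plin; [|exact: DT|exact: DT].
  by rewrite scalerBr opprD addrACA.
have r0 : 0 <= r := le_trans (normr_ge0 _) (xr 0%N).
pose q (p : nat * nat) (u : linfty R) : R^o := coord p.2 (Q u (x p.1)).
have qlin p : linear (q p).
  by move=> c u v; rewrite /q Qlin addopE scaleopE opD opZ.
have qbnd p : exists K, forall u, `|q p u| <= K * `|u|.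
  have C0 : 0 <= C := le_trans (normr_ge0 _) (fC 0%N).
  exists ((`|M| + 1) * C * r) => u.
  have QT : `|Q u| <= (`|M| + 1) * `|T u|.
    apply: le_trans (ler_normB _ _) _; rewrite mulrDl mul1r lerD2r.
    apply: le_trans (PM _ (DT u)) _; rewrite ler_wpM2r//; exact: ler_norm.
  apply: (@le_trans _ _ `|Q u (x p.1)|); first exact: linfty_norm_ge.
  apply: le_trans (le_opnorm _ _) _.
  apply: (@le_trans _ _ ((`|M| + 1) * (`|u| * C) * r)); last first.
    by rewrite le_eqVlt; apply/orP; left; apply/eqP; ring.
  apply: ler_pM => //; apply: le_trans QT _; rewrite ler_wpM2l ?addr_ge0//.
  exact: diagop_norm.
have /choice[psi psiE] p : exists g : dual (linfty R),
    forall u, g u = P (T u) (x p.1) p.2 - T u (x p.1) p.2.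
  by exists (mkop (qlin p) (qbnd p)) => u; rewrite mkopE.
have [|I [Iinf psiI]] := @vanishing_on_infinite_set R _ psi.
  by move=> p n; rewrite psiE PE ?subrr//; exact: diagop_unit_weakly_compact.
have PTI m n : P (T (chi I)) (x m) n = chi I n * (f n (x m) : R).
  by have := psiI (m, n); rewrite psiE => /eqP; rewrite subr_eq0 => /eqP.
have WP : W (P (T (chi I))) by rewrite -PW; exists (T (chi I)).
have : b <= a.
  apply: (weakly_compact_interchange WP xr Iinf) => m n mn In.
    by rewrite PTI chiE mem_set// mul1r ltW// fa.
  by rewrite PTI chiE mem_set// mul1r ltW// fb.
by rewrite leNgt ab.
Qed.

Lemma complemented_refl : complemented_in DP DP.
Proof.
split=> //; exists id; split=> //; last by rewrite image_id.
by exists 1 => u _; rewrite mul1r.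
Qed.

End equivalence.

Theorem corollary2p14 (R : realType) (X : completeNormedModType R) :
  (L_DP_property X <->
     weakly_compact_ops X (linfty R) = DPcc_ops X (linfty R)) /\
  (weakly_compact_ops X (linfty R) = DPcc_ops X (linfty R) <->
     complemented_in (weakly_compact_ops X (linfty R)) (DPcc_ops X (linfty R))).
Proof.
have WDc : weakly_compact_ops X (linfty R) = DPcc_ops X (linfty R) ->
    complemented_in (weakly_compact_ops X (linfty R)) (DPcc_ops X (linfty R)).
  by move=> ->; exact: complemented_refl.
split; split.
- exact: L_DP_property_weakly_compactE.
- by move=> /WDc; exact: complemented_L_DP_property.
- exact: WDc.
- by move=> /complemented_L_DP_property; exact: L_DP_property_weakly_compactE.
Qed.
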